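(* Let $\Gamma=(G,\sigma)$ be a balanced signed graph on $n$ vertices, and let $F_k(\Gamma)$ be its $k$-token signed graph for some integer $k$ with $1\le k\le n-1$. Then the Laplacian spectrum of $\Gamma$ is contained (as a multiset, i.e. counting multiplicities) in the Laplacian spectrum of $F_k(\Gamma)$.
   Context: All graphs are finite and simple. A signed graph $\Gamma=(G,\sigma)$ is a graph $G=(V,E)$ with a signature $\sigma:E\to\{+1,-1\}$. It is balanced if every cycle of $G$ has positive sign, the sign of a cycle being the product of the signs of its edges. The (signed) adjacency matrix $A$ of $\Gamma$ has entries $a_{uv}=\sigma(uv)$ if $uv\in E$ and $0$ otherwise; the Laplacian matrix is $L=D-A$, where $D$ is the diagonal matrix of vertex degrees in $G$. The Laplacian spectrum is the multiset of eigenvalues of $L$. The $k$-token signed graph $F_k(\Gamma)$ has as vertices the $k$-element subsets of $V$; two vertices $A,B$ are adjacent iff $A\,\Delta\, B=\{a,b\}$ with $a\in A$, $b\in B$, $ab\in E$, and the edge $AB$ then has sign $\sigma(ab)$. *)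

(* Defs.v *)
From HB Require Import structures.
From mathcomp Require Import all_boot all_order all_algebra.
From mathcomp Require Import finmap multiset.

Set Implicit Arguments.
Unset Strict Implicit.
Unset Printing Implicit Defensive.

Import GRing.Theory.
Local Open Scope ring_scope.

(* The signature is a function on ordered pairs that is only constrained on
   edges; its values on non-edges are junk and are never used. *)
Record signed_graph (V : finType) := SignedGraph {
  edge : rel V;
  sign : V -> V -> int;
  edge_sym : symmetric edge;
  edge_irr : irreflexive edge;
  sign_sym : forall u v, edge u v -> sign u v = sign v u;
  sign_pm1 : forall u v, edge u v -> sign u v = 1 \/ sign u v = -1
}.

Section SignedGraph.
Variables (V : finType) (G : signed_graph V).

(* The sequence of pairwise distinct vertices v_1, ..., v_m, with m >= 3, is
   the cycle with edges v_i v_(i+1) and v_m v_1. *)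
Definition is_cycle (c : seq V) : bool :=
  [&& (2 < size c)%N, uniq c & cycle (edge G) c].

Definition cycle_sign (c : seq V) : int := \prod_(x <- c) sign G x (next c x).

Definition balanced : Prop := forall c : seq V, is_cycle c -> cycle_sign c = 1.

Definition degree (v : V) : nat := #|[set w | edge G v w]|.

(* Rows and columns follow the enumeration of V; the spectrum does not depend
   on that order. *)
Definition adjacency_mx (R : pzRingType) : 'M[R]_#|V| :=
  \matrix_(i, j) if edge G (enum_val i) (enum_val j)
                 then (sign G (enum_val i) (enum_val j))%:~R else 0.

Definition degree_mx (R : pzRingType) : 'M[R]_#|V| :=
  diag_mx (\row_i (degree (enum_val i))%:R).

Definition laplacian_mx (R : pzRingType) : 'M[R]_#|V| :=
  degree_mx R - adjacency_mx R.

End SignedGraph.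

Section Spectrum.
Variable C : numClosedFieldType.

(* The roots of the characteristic polynomial, with multiplicities. *)
Definition spectrum (n : nat) (M : 'M[C]_n) : {mset C}%mset :=
  seq_mset (sval (closed_field_poly_normal (char_poly M))).

Lemma spectrumE (n : nat) (M : 'M[C]_n) (x : C) :
  spectrum M x = mup x (char_poly M).
Proof.
rewrite /spectrum mset_seqE; case: closed_field_poly_normal => s /= ->.
by rewrite (monicP (char_poly_monic M)) scale1r mu_prod_XsubC.
Qed.

Lemma mem_spectrum (n : nat) (M : 'M[C]_n) (x : C) :
  (x \in spectrum M) = eigenvalue M x.
Proof.
rewrite eigenvalue_root_char -mset_neq0 spectrumE -lt0n.
by rewrite mup_geq ?monic_neq0 ?char_poly_monic // expr1 dvdp_XsubCl.
Qed.

Definition laplacian_spectrum (V : finType) (G : signed_graph V) : {mset C}%mset :=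
  spectrum (laplacian_mx G C).

End Spectrum.

Section TokenGraph.
Variables (V : finType) (G : signed_graph V) (k : nat).

Definition ksubset : finType := {A : {set V} | #|A| == k}.

Definition symdiff (A B : {set V}) : {set V} := (A :\: B) :|: (B :\: A).

Definition token_move (A B : ksubset) (p : V * V) : bool :=
  [&& symdiff (val A) (val B) == [set p.1; p.2],
      p.1 \in val A, p.2 \in val B & edge G p.1 p.2].

Definition token_edge (A B : ksubset) : bool := [exists p, token_move A B p].

(* The pair picked here is unique, see token_signE. *)
Definition token_sign (A B : ksubset) : int :=
  if [pick p | token_move A B p] is Some p then sign G p.1 p.2 else 1.

Lemma token_moveP (A B : ksubset) (p : V * V) : token_move A B p ->
  val A :\: val B = [set p.1] /\ val B :\: val A = [set p.2].
Proof.
case: p => a b /and4P[/= /eqP eqD aA bB ab].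
have neq_ab : a != b by apply: contraTneq ab => ->; rewrite edge_irr.
have inD x : ((x \in val A) != (x \in val B)) = (x == a) || (x == b).
  move/setP/(_ x): eqD; rewrite !inE => <-.
  by case: (x \in val A); case: (x \in val B).
have aNB : a \notin val B by have := inD a; rewrite eqxx aA; case: (a \in _).
have bNA : b \notin val A.
  by have := inD b; rewrite eqxx orbT bB; case: (b \in _).
split; apply/setP=> x; rewrite !inE; have := inD x.
  case: (eqVneq x a) => [->|_]; first by rewrite aNB aA.
  case: (eqVneq x b) => [->|_]; first by rewrite bB.
  by case: (x \in val A); case: (x \in val B).
case: (eqVneq x b) => [->|_]; first by rewrite bNA bB.
case: (eqVneq x a) => [->|_]; first by rewrite aA.
by case: (x \in val A); case: (x \in val B).
Qed.

Lemma token_signE (A B : ksubset) (a b : V) :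
  token_move A B (a, b) -> token_sign A B = sign G a b.
Proof.
move=> mab; rewrite /token_sign; case: pickP => [[a' b'] m'|/(_ (a, b))].
  have [/= E1 E2] := token_moveP mab; have [/= E1' E2'] := token_moveP m'.
  have /set1_inj -> : [set a'] = [set a] by rewrite -E1 -E1'.
  by have /set1_inj -> : [set b'] = [set b] by rewrite -E2 -E2'.
by rewrite mab.
Qed.

Lemma token_move_sym (A B : ksubset) (a b : V) :
  token_move A B (a, b) -> token_move B A (b, a).
Proof.
move=> /and4P[/= /eqP eqD aA bB ab]; apply/and4P; split=> //=.
  by rewrite /symdiff setUC -/(symdiff _ _) eqD setUC.
by rewrite edge_sym.
Qed.

Fact token_edge_sym : symmetric token_edge.
Proof.
move=> A B; apply/existsP/existsP => -[[a b] m];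
  by exists (b, a); apply: token_move_sym.
Qed.

Fact token_edge_irr : irreflexive token_edge.
Proof.
move=> A; apply/existsP=> -[p /token_moveP[/setP/(_ p.1)]].
by rewrite setDv !inE eqxx.
Qed.

Fact token_sign_sym (A B : ksubset) :
  token_edge A B -> token_sign A B = token_sign B A.
Proof.
move=> /existsP[[a b] m].
rewrite (token_signE m) (token_signE (token_move_sym m)).
by apply: sign_sym; case/and4P: m.
Qed.

Fact token_sign_pm1 (A B : ksubset) :
  token_edge A B -> token_sign A B = 1 \/ token_sign A B = -1.
Proof.
move=> /existsP[[a b] m]; rewrite (token_signE m).
by apply: sign_pm1; case/and4P: m.
Qed.

Definition token_graph : signed_graph ksubset :=
  SignedGraph token_edge_sym token_edge_irr token_sign_sym token_sign_pm1.

End TokenGraph.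

(* Main.v *)
Require Import Defs.
From mathcomp Require Import all_boot all_order all_algebra.
From mathcomp Require Import finmap multiset zify.

(* A balanced signature is switching equivalent to the all-positive one:
   sigma(uv) = s(u) s(v) for some s : V -> {1, -1}, where s(v) is the sign of a
   path from a fixed vertex of the component to v. Extending s to k-subsets by
   s(A) = prod_(x in A) s(x) switches the token graph too. The matrix with
   entries s(v) s(A) if v \in A, and 0 otherwise, intertwines the two
   Laplacians, because moving a token along ab changes the indicator of v only
   for v = a and v = b. Its rows are independent for 1 <= k <= n - 1, so the
   characteristic polynomial of the small Laplacian divides the one of the
   large Laplacian. *)

Set Implicit Arguments.
Unset Strict Implicit.
Unset Printing Implicit Defensive.

Import GRing.Theory Num.Theory.
Local Open Scope ring_scope.

(** * Repetitions in sequences and subsets of given size *)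

Lemma not_uniq_split (T : eqType) (s : seq T) : ~~ uniq s ->
  exists y s1 s2 s3, s = s1 ++ y :: s2 ++ y :: s3.
Proof.
elim: s => //= x s IHs.
have [xs _|_ /= /IHs[y [s1 [s2 [s3 ->]]]]] := boolP (x \in s).
  by case/splitPr: xs => s2 s3; exists x, [::], s2, s3.
by exists y, (x :: s1), s2, s3.
Qed.

Lemma subset_of_card (T : finType) (A : {set T}) (m : nat) :
  (m <= #|A|)%N -> exists2 B : {set T}, B \subset A & #|B| = m.
Proof.
case/card_geqP=> s [Us <- sA]; exists [set x in s].
  by apply/subsetP=> x; rewrite inE => /sA.
by rewrite cardsE; apply/card_uniqP.
Qed.

(** * Signs of walks and the switching function of a balanced graph *)

Section Switching.
Variables (V : finType) (G : signed_graph V).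

Definition walk_sign (x : V) (p : seq V) : int :=
  \prod_(e <- pairmap (sign G) x p) e.

Lemma walk_sign_cat x p q :
  walk_sign x (p ++ q) = walk_sign x p * walk_sign (last x p) q.
Proof. by rewrite /walk_sign pairmap_cat big_cat. Qed.

Lemma walk_sign_cons x y p :
  walk_sign x (y :: p) = sign G x y * walk_sign y p.
Proof. by rewrite /walk_sign /= big_cons. Qed.

Lemma walk_sign_sqr x p :
  path (edge G) x p -> walk_sign x p * walk_sign x p = 1.
Proof.
elim: p x => [|y p IHp] x /=; first by rewrite /walk_sign big_nil.
case/andP=> xy /IHp; rewrite walk_sign_cons mulrACA => ->.
by case: (sign_pm1 xy) => ->.
Qed.

(** [next] unfolds to [next_at z x x p]. Separating the current vertex [y] from the wrap-around
    target [x] is what makes the induction on [p] go through. *)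
Lemma prod_next_at x y p : uniq (y :: p) ->
  \prod_(z <- y :: p) sign G z (next_at z x y p) = walk_sign y (rcons p x).
Proof.
elim: p y => [|y' p IHp] y.
  by rewrite /walk_sign /= !big_cons !big_nil eqxx.
rewrite cons_uniq => /andP[yNp Up].
rewrite big_cons rcons_cons walk_sign_cons -IHp //= eqxx; congr (_ * _).
apply: eq_big_seq => z zp; case: eqP => // zy.
by rewrite -zy zp in yNp.
Qed.

Lemma cycle_signE x p : uniq (x :: p) ->
  cycle_sign G (x :: p) = walk_sign x (rcons p x).
Proof. exact: prod_next_at. Qed.

(** Strong induction on length: a repeated vertex cuts the walk into two shorter closed walks whose
    signs multiply. Without repetition the walk is empty, an edge traversed back and forth, or a
    genuine cycle. *)
Lemma balanced_closed_walk x p : balanced G ->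
  path (edge G) x p -> last x p = x -> walk_sign x p = 1.
Proof.
move=> balG; have [m] := ubnP (size p).
elim: m => // m IHm in x p * => /ltnSE le_pm xp lxp.
have [Up|] := boolP (uniq p); last first.
  case/not_uniq_split=> y [p1 [p2 [p3 def_p]]].
  move: xp lxp le_pm; rewrite {}def_p -[y :: p2 ++ _]/([:: y] ++ p2 ++ _).
  rewrite !cat_path !last_cat /= => /and4P[xp1 /andP[p1y _] yp2 /andP[p2y yp3]].
  move=> lyp3 le_pm.
  (* The two pieces are the walk from [x] with its loop at [y] cut out, and that loop itself. *)
  have le_p13 : (size (p1 ++ y :: p3) < m)%N.
    by apply: leq_trans le_pm; rewrite !size_cat /= !size_cat /= ltn_add2l; lia.
  have le_p2 : (size (rcons p2 y) < m)%N.
    by apply: leq_trans le_pm; rewrite size_rcons !size_cat /= !size_cat /=; lia.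
  have := IHm x (p1 ++ y :: p3) le_p13.
  rewrite cat_path last_cat /= xp1 p1y yp3 => /(_ isT lyp3).
  have := IHm y (rcons p2 y) le_p2.
  rewrite rcons_path last_rcons yp2 p2y => /(_ isT erefl).
  rewrite -cats1 !walk_sign_cat !walk_sign_cons walk_sign_cat walk_sign_cons.
  rewrite /= {2}/walk_sign big_nil mulr1 => cyc2 cyc13.
  by rewrite [walk_sign y p2 * _]mulrA cyc2 mul1r.
case: (lastP p) => [|q y] in xp lxp Up *; first by rewrite /walk_sign big_nil.
rewrite last_rcons in lxp; rewrite {}lxp in xp Up *.
(* Length one would be a loop, length two squares one edge sign, and from length three on balance
   applies. *)
case: q => [|z q] in xp Up *; first by rewrite /= edge_irr in xp.
case: q => [|t q] in xp Up *.
  case/and3P: xp => xz zx _.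
  rewrite /walk_sign /= !big_cons big_nil mulr1 -(sign_sym xz).
  by case: (sign_pm1 xz) => ->.
rewrite rcons_uniq in Up; rewrite -cycle_signE //; apply: balG.
by rewrite /is_cycle cons_uniq Up.
Qed.

Lemma balanced_switching : balanced G ->
  exists s : V -> int, (forall v, s v * s v = 1) /\
    (forall u v, edge G u v -> sign G u v = s u * s v).
Proof.
move=> balG; have symG : connect_sym (edge G).
  by apply: sym_connect_sym; apply: edge_sym.
have ex_path v : exists p, path (edge G) (fingraph.root (edge G) v) p /\
    last (fingraph.root (edge G) v) p = v.
  have /connectP[p Gp lp] : connect (edge G) (fingraph.root (edge G) v) v.
    by rewrite symG connect_root.
  by exists p.
have [p pP] := fin_all_exists ex_path.
pose s v := walk_sign (fingraph.root (edge G) v) (p v).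
have s_sqr v : s v * s v = 1 by apply: walk_sign_sqr; case: (pP v).
exists s; split=> // u v uv.
have eq_root : fingraph.root (edge G) u = fingraph.root (edge G) v.
  by apply/eqP; rewrite root_connect // connect1.
have [Gpu lpu] := pP u; have [Gpv lpv] := pP v.
(* The walk [q] back to the root closes both the chosen path to [v] and the chosen path to [u]
   extended by [uv], so both closed walks have sign 1. *)
have /connectP[q Gq lq] := connect_root (edge G) v.
have sv_q : s v * walk_sign v q = 1.
  rewrite -{2}lpv -walk_sign_cat; apply: balanced_closed_walk => //.
    by rewrite cat_path Gpv lpv.
  by rewrite last_cat lpv.
have suv_q : s u * (sign G u v * walk_sign v q) = 1.
  rewrite -walk_sign_cons -{2}lpu -walk_sign_cat.
  apply: balanced_closed_walk => //; first by rewrite cat_path Gpu lpu /= uv.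
  by rewrite last_cat lpu /= -lq eq_root.
have wqE : walk_sign v q = s v.
  by rewrite -[LHS]mul1r -(s_sqr v) -mulrA sv_q mulr1.
rewrite wqE in suv_q.
by rewrite -[RHS]mulr1 -suv_q mulrACA s_sqr mul1r mulrCA s_sqr mulr1.
Qed.

End Switching.

(** * Divisibility of characteristic polynomials *)

Lemma char_poly_dvd_intertwine (F : fieldType) (n m : nat)
    (P : 'M[F]_(n, m)) (A : 'M[F]_m) (B : 'M[F]_n) :
  row_free P -> P *m A = B *m P -> char_poly B %| char_poly A.
Proof.
move=> Pfree; have le_nm : (n <= m)%N by rewrite -(eqP Pfree) rank_leq_col.
have [r def_m] : exists r, m = (n + r)%N by exists (m - n)%N; rewrite subnKC.
case: _ / (esym def_m) in P A Pfree le_nm *; move=> PA.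
(* [U] completes the rows of [P] to a basis: the rank factorization of [P] is enlarged by an
   identity block. *)
pose U := block_mx (col_ebase P) 0 0 1%:M *m row_ebase P.
have Uunit : U \in unitmx.
  rewrite unitmx_mul row_ebase_unit andbT unitmxE det_ublock det1 mulr1.
  by rewrite -unitmxE col_ebase_unit.
have defP : usubmx U = P.
  have := mulmx_ebase P; rewrite (eqP Pfree : \rank P = n) pid_mx_row.
  by rewrite /U block_mxEv mul_col_mx col_mxKu mul_mx_row mulmx1 mulmx0.
(* The row space of [P] is stable under [A], so in the basis [U] the matrix [A] becomes block lower
   triangular with [B] as its first diagonal block. *)
have [D UA] : exists D, U *m A = col_mx (row_mx B 0) D *m U.
  exists (dsubmx U *m A *m invmx U).
  rewrite -{1}[U]vsubmxK defP !mul_col_mx mulmxKV // PA; congr col_mx.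
  by rewrite -[in RHS](vsubmxK U) defP mul_row_col mul0mx addr0.
pose T := col_mx (row_mx B 0) D.
have : map_mx polyC U *m char_poly_mx A = char_poly_mx T *m map_mx polyC U.
  by rewrite /char_poly_mx mulmxBr mulmxBl -!map_mxM UA scalar_mxC.
move/(congr1 determinant); rewrite !det_mulmx mulrC.
have dU0 : \det (map_mx polyC U) != 0.
  by rewrite det_map_mx polyC_eq0 -unitfE -unitmxE.
move/(mulIf dU0); rewrite -/(char_poly A) => ->.
have -> : T = block_mx B 0 (lsubmx D) (rsubmx D).
  by rewrite block_mxEv hsubmxK.
rewrite /char_poly_mx map_block_mx scalar_mx_block opp_block_mx add_block_mx.
by rewrite map_mx0 oppr0 addr0 det_lblock dvdp_mulIl.
Qed.

(** * Symmetry of the Laplacian and its action on switched functions *)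

Lemma trmx_laplacian (V : finType) (G : signed_graph V) (R : pzRingType) :
  (laplacian_mx G R)^T = laplacian_mx G R.
Proof.
rewrite /laplacian_mx linearB /= tr_diag_mx; congr (_ - _).
apply/matrixP=> i j; rewrite !mxE edge_sym; case: ifP => // ij.
by rewrite (sign_sym ij).
Qed.

(* On switched functions the Laplacian acts as the unsigned one. *)
Lemma laplacian_mx_switched (R : comNzRingType) (V : finType)
    (G : signed_graph V) (s f : V -> R) (i : 'I_#|V|) :
  (forall v, s v * s v = 1) ->
  (forall u v, edge G u v -> (sign G u v)%:~R = s u * s v) ->
  \sum_j laplacian_mx G R i j * (s (enum_val j) * f (enum_val j)) =
  s (enum_val i) * \sum_(w | edge G (enum_val i) w) (f (enum_val i) - f w).
Proof.
move=> s_sqr sE; set x := enum_val i.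
rewrite sumrB mulrBr sumr_const -mulr_natl.
transitivity (\sum_j degree_mx G R i j * (s (enum_val j) * f (enum_val j)) -
  \sum_j adjacency_mx G R i j * (s (enum_val j) * f (enum_val j))).
  by rewrite -sumrB; apply: eq_bigr => j _; rewrite !mxE mulrBl.
congr (_ - _).
  rewrite (bigD1 i) //= !mxE eqxx mulr1n big1 ?addr0 => [|j].
    by rewrite mulrCA /degree cardsE.
  by rewrite eq_sym !mxE => /negPf->; rewrite mul0r.
rewrite mulr_sumr [RHS]big_mkcond /=.
rewrite (big_enum_val (fun w => if edge G x w then s x * f w else 0)) /=.
apply: eq_bigr => j _; rewrite !mxE -/x.
case: ifP => [/sE->|_]; last by rewrite mul0r.
by rewrite -mulrA [s (enum_val j) * (_ * _)]mulrA s_sqr mul1r.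
Qed.

(** * Functions whose sums over k-subsets vanish *)

Lemma sum_subsets_eq0 (R : numDomainType) (V : finType) (k : nat) (g : V -> R) :
  (0 < k < #|V|)%N ->
  (forall A : {set V}, #|A| = k -> \sum_(w in A) g w = 0) -> forall w, g w = 0.
Proof.
case/andP=> k_gt0 k_lt g0 w.
have g_const u v : g u = g v.
  have [-> //|neq_uv] := eqVneq u v.
  (* Adding [u] or [v] to [C] gives two k-sets with zero sum, hence [g u = g v]. Such a [C] exists
     since k - 1 <= |V| - 2. A constant [g] then satisfies k g = 0. *)
  have [|C sC cardC] := @subset_of_card _ (~: [set u; v]) k.-1.
    by have := cardsC [set u; v]; rewrite cards2 neq_uv; lia.
  have notC x : x \in [set u; v] -> x \notin C.
    by apply: contraL => /(subsetP sC); rewrite inE.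
  have uC : u \notin C by rewrite notC ?set21.
  have vC : v \notin C by rewrite notC ?set22.
  apply: (@addIr _ (\sum_(x in C) g x)).
  by rewrite -!big_setU1 ?g0 // cardsU1 cardC (uC, vC) add1n prednK.
have [|A _ cardA] := @subset_of_card _ [set: V] k; first by rewrite cardsT ltnW.
have := g0 A cardA; rewrite (eq_bigr (fun=> g w)) => [|v _]; last exact: g_const.
by rewrite sumr_const cardA => /eqP; rewrite mulrn_eq0 eqn0Ngt k_gt0 /= => /eqP.
Qed.

(** * Token moves and the intertwining relation *)

Section TokenLaplacian.
Variables (V : finType) (G : signed_graph V) (k : nat).
Implicit Types A B : ksubset V k.

Definition movable A (p : V * V) :=
  [&& p.1 \in val A, p.2 \notin val A & edge G p.1 p.2].

(** The target is a function of [A] and [p], so sums over neighbours of [A] can be reindexed by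
    vertex pairs. *)
Lemma token_moveE A B p :
  token_move G A B p = movable A p && (val B == p.2 |: val A :\ p.1).
Proof.
case: p => a b; apply/idP/andP => [mp|[/and3P[/= aA bA ab] /eqP defB]].
  have [/= dAB dBA] := token_moveP mp; case/and4P: (mp) => /= _ aA bB ab.
  have bA : b \notin val A.
    by have /setP/(_ b) := dBA; rewrite !inE eqxx bB andbT.
  split; first exact/and3P.
  apply/eqP/setP=> x; rewrite !inE.
  have /setP/(_ x) := dAB; have /setP/(_ x) := dBA; rewrite !inE => <- <-.
  by case: (x \in val A); case: (x \in val B).
have neq_ab : a != b by apply: contraTneq ab => ->; rewrite edge_irr.
apply/and4P; split=> //=; last by rewrite defB !inE eqxx.
apply/eqP/setP=> x; rewrite /symdiff defB !inE.
have [->|neq_xa] := eqVneq x a; first by rewrite (negPf neq_ab) aA.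
have [->|neq_xb] := eqVneq x b; first by rewrite bA.
by case: (x \in val A).
Qed.

Lemma movable_cardE A p : movable A p -> #|p.2 |: val A :\ p.1| == k.
Proof.
case/and3P=> aA bA _; rewrite cardsU1 !inE (negPf bA) andbF add1n.
by have := cardsD1 p.1 (val A); rewrite aA (eqP (valP A)) add1n => <-.
Qed.

Lemma sum_token_edge (R : nmodType) A (F : ksubset V k -> V * V -> R) :
  \sum_(B | token_edge G A B) \sum_(p | token_move G A B p) F B p =
  \sum_(p | movable A p) F (insubd A (p.2 |: val A :\ p.1)) p.
Proof.
(* The default value [A] is never reached on movable pairs, where the new set has k elements. *)
pose mv p : ksubset V k := insubd A (p.2 |: val A :\ p.1).
have val_mv p : movable A p -> val (mv p) = p.2 |: val A :\ p.1.
  by move/movable_cardE=> cardE; rewrite val_insubd cardE.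
have mvP p : movable A p -> token_move G A (mv p) p.
  by move=> Ap; rewrite token_moveE Ap val_mv // eqxx.
rewrite [RHS](partition_big mv (token_edge G A)) => [|p Ap]; last first.
  by apply/existsP; exists p; apply: mvP.
apply: eq_bigr => B _; apply: eq_big => [p|p].
  rewrite token_moveE; case Ap: (movable A p) => //=.
  by rewrite -val_mv // -val_eqE eq_sym.
rewrite token_moveE => /andP[Ap /eqP defB].
by congr F; apply: val_inj; rewrite defB val_mv.
Qed.

Lemma token_move_inj A B p q :
  token_move G A B p -> token_move G A B q -> p = q.
Proof.
case: p q => [a b] [a' b'] /token_moveP[/= dAB dBA] /token_moveP[/= dAB' dBA'].
by congr (_, _); apply: set1_inj; rewrite -?dAB -?dBA.
Qed.

(* Only the moves along edges at [v] change the indicator of [v]. *)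
Lemma sum_indicator_token_edge (R : pzRingType) A v :
  \sum_(B | token_edge G A B) ((v \in val A)%:R - (v \in val B)%:R) =
  \sum_(w | edge G v w) ((v \in val A)%:R - (w \in val A)%:R) :> R.
Proof.
transitivity (\sum_(B | token_edge G A B) \sum_(p | token_move G A B p)
                ((v == p.1)%:R - (v == p.2)%:R) : R).
  apply: eq_bigr => B /existsP[p mp]; rewrite (big_pred1 p) => [|q]; last first.
    by apply/idP/eqP => [/token_move_inj/(_ mp)|->].
  move: (mp); rewrite token_moveE => /andP[/and3P[aA bA _] /eqP->].
  rewrite !inE; case: (eqVneq v p.2) => [->|_] /=.
    by rewrite (negPf bA); case: eqP aA bA => // -> ->.
  by case: (eqVneq v p.1) => [->|_] /=; rewrite ?aA ?subr0 ?subrr.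
(* Over pairs, the first sum keeps only moves out of [v] and the second only moves into [v]. For
   each neighbour [w], at most one of the moves [(v, w)] and [(w, v)] is possible, which yields the
   difference of indicators. *)
rewrite sum_token_edge sumrB big_mkcond -(pair_bigA _ (fun a b =>
  if movable A (a, b) then (v == a)%:R else 0)) /=.
rewrite [X in _ - X]big_mkcond -(pair_bigA _ (fun a b =>
  if movable A (a, b) then (v == b)%:R else 0)) /=.
rewrite [X in _ - X]exchange_big /=.
rewrite (bigD1 v) //= [X in _ + X - _]big1 ?addr0; last first.
  move=> a /negPf neq_av.
  by apply: big1 => b _; rewrite eq_sym neq_av if_same.
rewrite [X in _ - X](bigD1 v) //= [X in _ - (_ + X)]big1 ?addr0; last first.
  move=> b /negPf neq_bv.
  by apply: big1 => a _; rewrite eq_sym neq_bv if_same.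
rewrite -sumrB [RHS]big_mkcond /=; apply: eq_bigr => w _.
rewrite /movable /= eqxx [edge G w v]edge_sym.
by case: (v \in val A); case: (w \in val A); case: (edge G v w);
  rewrite /= ?subrr ?subr0.
Qed.

Variables (R : comNzRingType) (s : V -> R).
Hypothesis s_sqr : forall v, s v * s v = 1.
Hypothesis sE : forall u v, edge G u v -> (sign G u v)%:~R = s u * s v.

Definition token_switch A : R := \prod_(x in val A) s x.

Lemma token_switch_sqr A : token_switch A * token_switch A = 1.
Proof. by rewrite -big_split /= big1. Qed.

Lemma token_switchE A B : edge (token_graph G k) A B ->
  (sign (token_graph G k) A B)%:~R = token_switch A * token_switch B.
Proof.
case/existsP=> -[a b] mp; rewrite /= (token_signE mp).
move: mp; rewrite token_moveE => /andP[/and3P[aA bA ab] /eqP defB].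
rewrite /= in aA bA ab; rewrite sE // /token_switch defB big_setU1 ?inE ?(negPf bA) ?andbF //=.
(* The factor [P] of the tokens that stay in place occurs in both switching values and squares to
   1. *)
rewrite (big_setD1 a) //= mulrACA; set P := \prod_(x in _) _.
have P2 : P * P = 1 by rewrite -big_split /= big1.
by rewrite mulrCA [P * (_ * _)]mulrCA P2 mulr1 mulrC.
Qed.

Definition token_incidence_mx : 'M[R]_(#|V|, #|ksubset V k|) :=
  \matrix_(i, j) (s (enum_val i) * token_switch (enum_val j) *
                  (enum_val i \in val (enum_val j))%:R).

Lemma token_incidence_intertwine :
  token_incidence_mx *m laplacian_mx (token_graph G k) R =
  laplacian_mx G R *m token_incidence_mx.
Proof.
apply/matrixP=> i j.
(* By symmetry, both products become a Laplacian row acting on a switched function: of k-subsets on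
   the left, of vertices on the right. *)
rewrite -[laplacian_mx (token_graph G k) R]trmx_laplacian !mxE.
set v := enum_val i; set A := enum_val j.
transitivity (\sum_l laplacian_mx (token_graph G k) R j l *
    (token_switch (enum_val l) * (s v * (v \in val (enum_val l))%:R))).
  by apply: eq_bigr => l _; rewrite !mxE mulrC [s _ * _]mulrC -mulrA.
rewrite (laplacian_mx_switched (fun B => s v * (v \in val B)%:R));
  [|exact: token_switch_sqr|exact: token_switchE].
transitivity (\sum_l laplacian_mx G R i l *
    (s (enum_val l) * (token_switch A * (enum_val l \in val A)%:R))); last first.
  by apply: eq_bigr => l _; rewrite !mxE -[in RHS]mulrA.
rewrite (laplacian_mx_switched (fun w => token_switch A * (w \in val A)%:R)) //.
under eq_bigr do rewrite -mulrBr.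
under [in RHS]eq_bigr do rewrite -mulrBr.
rewrite -!mulr_sumr -/v -/A sum_indicator_token_edge.
by rewrite mulrCA.
Qed.

End TokenLaplacian.

(** * Independence of the rows and inclusion of the spectra *)

Lemma row_free_token_incidence (F : numFieldType) (V : finType) (k : nat)
    (s : V -> F) :
  (forall v, s v * s v = 1) -> (0 < k < #|V|)%N ->
  row_free (token_incidence_mx k s).
Proof.
move=> s_sqr lt_k; apply: inj_row_free => x xM0.
have s_neq0 v : s v != 0.
  by apply: contra_eq_neq (s_sqr v) => ->; rewrite mul0r eq_sym oner_neq0.
suff g0 w : x 0 (enum_rank w) * s w = 0.
  apply/rowP=> i; rewrite mxE; apply: (mulIf (s_neq0 (enum_val i))).
  by have := g0 (enum_val i); rewrite enum_valK mul0r.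
apply: (sum_subsets_eq0 (g := fun w => x 0 (enum_rank w) * s w) lt_k) => A.
move/eqP=> cardA; pose B : ksubset V k := Sub A cardA.
(* The column of [B] says that [token_switch s B] times the sum over [A] of
   [x 0 (enum_rank w) * s w] is zero. *)
have /rowP/(_ (enum_rank B)) := xM0; rewrite !mxE.
have SB_neq0 : token_switch s B != 0.
  by apply: contra_eq_neq (token_switch_sqr s_sqr B) => ->;
    rewrite mul0r eq_sym oner_neq0.
move=> sum0; apply: (mulIf SB_neq0); rewrite mul0r -[RHS]sum0.
rewrite mulr_suml big_mkcond (big_enum_val (fun w =>
  if w \in A then x 0 (enum_rank w) * s w * token_switch s B else 0)) /=.
apply: eq_bigr => i _; rewrite mxE enum_rankK enum_valK /= mulrA mulrA.
by case: ifP => _; rewrite ?mulr1 ?mulr0.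
Qed.

Theorem theorem6p2 (C : numClosedFieldType) (V : finType)
    (Gamma : signed_graph V) (n k : nat) :
  #|V| = n -> balanced Gamma -> (1 <= k <= n - 1)%N ->
  (laplacian_spectrum C Gamma `<=`
     laplacian_spectrum C (token_graph Gamma k))%mset.
Proof.
move=> cardV /balanced_switching[s [s_sqr sE]] k_bounds.
pose t v : C := (s v)%:~R.
have t_sqr v : t v * t v = 1 by rewrite -intrM s_sqr.
have tE u v : edge Gamma u v -> (sign Gamma u v)%:~R = t u * t v.
  by move/sE->; rewrite intrM.
have lt_k : (0 < k < #|V|)%N by lia.
have dvdL : char_poly (laplacian_mx Gamma C) %|
            char_poly (laplacian_mx (token_graph Gamma k) C).
  apply: char_poly_dvd_intertwine (row_free_token_incidence t_sqr lt_k) _.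
  exact: token_incidence_intertwine.
have char_neq0 m (A : 'M[C]_m) : char_poly A != 0.
  exact/monic_neq0/char_poly_monic.
(* Inclusion is compared root by root: the power of X - x dividing the small characteristic
   polynomial divides the large one. *)
apply/msubsetP=> x; rewrite /laplacian_spectrum !spectrumE mup_geq //.
by apply: dvdp_trans dvdL; rewrite -mup_geq.
Qed.
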